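(* Let the standing setting and assumptions given in the context hold, let $\{\alpha_k\}_{k\ge 0}$ be nonnegative with $\sum_{k=0}^\infty\sqrt{\alpha_k}<\infty$, and let $\{x_k\}$ and $\{\lambda_k\}$ be generated by the misspecified inexact augmented Lagrangian scheme (defined in the context) with constant penalty $\rho>0$ and $\lambda_0=\mathbf 0$. Let $\bar x_k:=\frac1{k+1}\sum_{i=0}^kx_i$. Then for any $\lambda^*\in\operatorname{argmax}_\lambda g_0(\lambda;\theta^* )$ and all $k\ge1$, $$f(\bar x_k;\theta^* )-f^*\ge-\frac\rho2\mathcal V^2(k)-\|\lambda^*\|\,\mathcal V(k),$$ $$f(\bar x_k;\theta^* )-f^*\le\frac Uk,$$ where $$\mathcal V(k):=\frac{C_1}{\sqrt{k+1}}+\frac{C_2}{k+1},\quad C_1:=\sqrt{\frac{2B_g}{\rho}+\left(\frac{C_\lambda}{\rho}\right)^2},\quad C_2:=\sqrt{\tfrac2\rho}\sum_{i=0}^\infty\sqrt{\alpha_i}+\frac{(L_h+M_h)\|\theta_0-\theta^*\|}{1-q_\ell},$$ $$C_\lambda:=\sqrt{2\rho}\sum_{i=0}^\infty\sqrt{\alpha_i}+\rho M_h\frac{\|\theta_0-\theta^*\|}{1-q_\ell}+\|\lambda^*\|,\qquad B_g:=\frac{1}{2\rho}\|\lambda^*\|^2+C_\lambda\left(\sqrt{\tfrac{2}{\rho}}\sum_{k=0}^\infty\sqrt{\alpha_k}+\frac{M_h\|\theta_0-\theta^*\|}{1-q_\ell}\right),$$ $$U:=\frac\rho2L_h^2\frac{\|\theta_0-\theta^*\|^2}{1-q_\ell^2}+\left(\bar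 CL_h+2L_f\right)\frac{\|\theta_0-\theta^*\|}{1-q_\ell}+\sum_{i=0}^\infty\alpha_i,\qquad\bar C:=C_\lambda+\|\lambda^*\|.$$
   Context: Notation: $\|\cdot\|$ is the Euclidean norm; $B(0,1)$ is the closed unit ball; for a closed convex set $S$, $d_S(x)=\min_{s\in S}\|x-s\|$ and $d_S^2(x)=(d_S(x))^2$; $\mathbb R^m_+$, $\mathbb R^m_-$ are the nonnegative and nonpositive orthants. Problem. $X\subseteq\mathbb R^n$ and $\Theta\subseteq\mathbb R^d$ are convex compact sets, $f:\mathbb R^n\times\Theta\to\mathbb R\cup\{+\infty\}$, $h:\mathbb R^n\times\Theta\to\mathbb R^m$. For $\theta\in\Theta$, $\mathcal C(\theta)$ is the problem $\min\{f(x;\theta): h(x;\theta)\le 0,\ x\in X\}$. The true parameter $\theta^*\in\Theta$ is the unique minimizer over $\Theta$ of a learning objective $\ell$. $\mathcal C(\theta^* )$ has a finite optimal value $f^*$, its Lagrangian dual has a solution, and there is no duality gap. For $\rho>0$, $x\in X$, $\lambda\in\mathbb R^m$, $\theta\in\Theta$, the augmented Lagrangian is $$\mathcal L_\rho(x,\lambda;\theta)=f(x;\theta)+\tfrac{\rho}{2}d^2_{\mathbb R^m_-}\left(\tfrac{\lambda}{\rho}+h(x;\theta)\right)-\tfrac{\|\lambda\|^2}{2\rho}.$$ For $\rho=0$, $\mathcal L_0(x,\lambda;\theta)=f(x;\theta)+\lambda^\top h(x;\theta)$ if $\lambda\in\mathbb R^m_+$ and $-\infty$ otherwise. For $\rho\ge0$,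 $g_\rho(\lambda;\theta)=\inf_{x\in X}\mathcal L_\rho(x,\lambda;\theta)$; the Lagrangian dual of $\mathcal C(\theta)$ is $\max_\lambda g_0(\lambda;\theta)$. Standing assumptions: (i) $f(x;\theta)$ and each $h_j(x;\theta)$, $j=1,\dots,m$, are convex in $x\in X$ for all $\theta\in\Theta$. (ii) $|f(x;\theta_1)-f(x;\theta_2)|\le L_f\|\theta_1-\theta_2\|$ for all $x\in X$, $\theta_1,\theta_2\in\Theta$. (iii) $h(x;\theta)=A(\theta)x+b(\theta)$ with $A(\theta)\in\mathbb R^{m\times n}$, $b(\theta)\in\mathbb R^m$ Lipschitz continuous in $\theta$; $L_h$ is a constant with $\|h(x;\theta_1)-h(x;\theta_2)\|\le L_h\|\theta_1-\theta_2\|$ for all $x\in X$, $\theta_1,\theta_2\in\Theta$, and $\sigma_h$ is a constant with $h(B(0,1);\theta)\subseteq\sigma_hB(0,1)$ for all $\theta\in\Theta$. (iv) With $X^*(\lambda;\theta)=\operatorname{argmin}_{x\in X}\mathcal L_0(x,\lambda;\theta)$, there is $\kappa_X$ such that $X^*(\lambda;\theta_1)\subseteq X^*(\lambda;\theta_2)+\kappa_X\|\theta_1-\theta_2\|B(0,1)$ for all $\lambda\ge0$ and $\theta_1,\theta_2\in\Theta$. (v) $\{\theta_k\}_{k\ge0}\subset\Theta$ is a sequence with $\|\theta_k-\theta^*\|\le q_\ell^k\|\theta_0-\theta^*\|$ for all $k\ge0$, where $q_\ell\in(0,1)$. Constant $M_h$: $M_h\ge 0$ denotes a Lipschitz constant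 of $\nabla_\lambda g_\rho(\lambda;\cdot)$ on $\Theta$, uniform in $\lambda$, i.e. $\|\nabla_\lambda g_\rho(\lambda;\theta_1)-\nabla_\lambda g_\rho(\lambda;\theta_2)\|\le M_h\|\theta_1-\theta_2\|$ for all $\lambda\in\mathbb R^m$, $\theta_1,\theta_2\in\Theta$ (for $\rho>0$, $g_\rho(\cdot;\theta)$ is everywhere finite, concave and continuously differentiable). Misspecified inexact augmented Lagrangian scheme: given $\rho>0$, $\lambda_0=\mathbf 0\in\mathbb R^m$, and sequences $\{\alpha_k\}$, $\{\theta_k\}$, for each $k\ge0$: (1) choose any $x_k\in X$ with $\mathcal L_\rho(x_k,\lambda_k;\theta_k)\le g_\rho(\lambda_k;\theta_k)+\alpha_k$; (2) set $\lambda_{k+1}=\lambda_k+\rho\nabla_\lambda\mathcal L_\rho(x_k,\lambda_k;\theta_k)$. *)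

(* Defs.v *)
From mathcomp Require Import all_boot all_order all_algebra.
From mathcomp Require Import all_classical all_reals all_analysis.
Set Implicit Arguments.
Unset Strict Implicit.
Unset Printing Implicit Defensive.
Import Order.TTheory GRing.Theory Num.Theory.
Import numFieldNormedType.Exports.
Local Open Scope classical_set_scope.
Local Open Scope ring_scope.

(* The library's norm on matrices is the max norm, hence a separate Euclidean
   norm. Both induce the same topology. *)
Definition enorm (R : realType) (n : nat) (x : 'cV[R]_n) : R :=
  Num.sqrt (\sum_(i < n) x i 0 ^+ 2).

Definition unit_ball (R : realType) (n : nat) : set 'cV[R]_n :=
  [set x | enorm x <= 1].

Definition nonneg_orthant (R : realType) (m : nat) : set 'cV[R]_m :=
  [set x | forall j, 0 <= x j 0].

Definition nonpos_orthant (R : realType) (m : nat) : set 'cV[R]_m :=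
  [set x | forall j, x j 0 <= 0].

(* The infimum is attained when S is closed and nonempty. *)
Definition edist (R : realType) (n : nat) (S : set 'cV[R]_n) (x : 'cV[R]_n) : R :=
  inf [set enorm (x - s) | s in S].

Definition grad (R : realType) (m : nat) (F : 'cV[R]_m -> R) (x : 'cV[R]_m)
    : 'cV[R]_m :=
  \col_(j < m) 'D_(delta_mx j 0) F x.

(* Convexity of an extended-valued function; the library's convex_function is
   for real-valued functions only. *)
Definition econvex_on (R : realType) (n : nat) (X : set 'cV[R]_n)
    (F : 'cV[R]_n -> \bar R) : Prop :=
  forall (x y : 'cV[R]_n) (t : R), X x -> X y -> 0 <= t <= 1 ->
    (F (t *: x + (1 - t) *: y)%R <= t%:E * F x + (1 - t)%:E * F y)%E.

Section Problem.
Context (R : realType) (n d m : nat).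
Context (f : 'cV[R]_n -> 'cV[R]_d -> \bar R).
Context (h : 'cV[R]_n -> 'cV[R]_d -> 'cV[R]_m).
Context (X : set 'cV[R]_n).

Definition opt_value (theta : 'cV[R]_d) : \bar R :=
  ereal_inf [set f x theta | x in X `&` [set x | nonpos_orthant (h x theta)]].

Definition aug_lagrangian (rho : R) (x : 'cV[R]_n) (l : 'cV[R]_m)
    (theta : 'cV[R]_d) : \bar R :=
  if rho == 0 then
    if l \in @nonneg_orthant R m then
      (f x theta + ((l^T *m h x theta) 0 0)%:E)%E
    else -oo%E
  else
    (f x theta
     + (rho / 2 * edist (@nonpos_orthant R m) (rho^-1 *: l + h x theta) ^+ 2
        - enorm l ^+ 2 / (2 * rho))%:E)%E.

Definition dual_fun (rho : R) (l : 'cV[R]_m) (theta : 'cV[R]_d) : \bar R :=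
  ereal_inf [set aug_lagrangian rho x l theta | x in X].

Definition dual_solutions (theta : 'cV[R]_d) : set 'cV[R]_m :=
  [set l | forall mu, (dual_fun 0 mu theta <= dual_fun 0 l theta)%E].

Definition argmin_lagrangian (l : 'cV[R]_m) (theta : 'cV[R]_d) : set 'cV[R]_n :=
  [set x | X x /\
     forall y, X y -> (aug_lagrangian 0 x l theta <= aug_lagrangian 0 y l theta)%E].

(* [fine] loses nothing in the two gradients: for rho > 0, dual_fun rho is
   finite in l in the situations considered, and aug_lagrangian rho x l theta
   is finite in l as soon as f x theta is. *)
Definition grad_dual (rho : R) (l : 'cV[R]_m) (theta : 'cV[R]_d) : 'cV[R]_m :=
  grad (fun mu => fine (dual_fun rho mu theta)) l.

Definition grad_lagrangian (rho : R) (x : 'cV[R]_n) (l : 'cV[R]_m)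
    (theta : 'cV[R]_d) : 'cV[R]_m :=
  grad (fun mu => fine (aug_lagrangian rho x mu theta)) l.

Definition inexact_alm (rho : R) (alpha : nat -> R) (theta : nat -> 'cV[R]_d)
    (x : nat -> 'cV[R]_n) (l : nat -> 'cV[R]_m) : Prop :=
  l 0%N = 0 /\
  forall k,
    [/\ X (x k),
        (aug_lagrangian rho (x k) (l k) (theta k)
           <= dual_fun rho (l k) (theta k) + (alpha k)%:E)%E
      & l k.+1 = l k + rho *: grad_lagrangian rho (x k) (l k) (theta k)].

End Problem.

Definition running_avg (R : realType) (n : nat) (x : nat -> 'cV[R]_n) (k : nat)
    : 'cV[R]_n :=
  k.+1%:R^-1 *: \sum_(i < k.+1) x i.

(* Main.v *)
(** The augmented dual function [g_rho l] is the infimum of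
    [c + <l, w> + rho/2 |w|^2] over the convex set of pairs [(c, w)] with
    [F x <= c], [h x <= w] for some [x] in [X]. Strong convexity in [w] gives
    [g l + <d, p> - |d|^2/(2 rho) <= g (l + d) <= g l + <d, p>] for some [p],
    so that [p] is the gradient; it is within [sqrt (2 alpha / rho)] of the [w]
    of any [alpha]-minimizer, and [l + rho p] is no farther than [l] from any
    maximizer of [g]. Hence [|lambda_k - lambda^*| <= C_lambda].

    The lower bound follows from [f^* <= f xbar + <lambda^*, h xbar>], since the
    averaged slacks telescope to [lambda_(k+1) / (rho (k+1))]; this is of order
    [1/k], and [k >= 1] lets the term [C_1 / sqrt (k+1)] dominate it. The upper
    bound sums the inexact optimality conditions, in which
    [(|lambda_(i+1)|^2 - |lambda_i|^2) / (2 rho)] telescopes. *)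
Require Import Defs.
From mathcomp Require Import all_boot all_order all_algebra.
From mathcomp Require Import all_classical all_reals all_analysis.
From mathcomp Require Import ring lra.
Set Implicit Arguments.
Unset Strict Implicit.
Unset Printing Implicit Defensive.
Import Order.TTheory GRing.Theory Num.Theory.
Import numFieldNormedType.Exports.
Local Open Scope classical_set_scope.
Local Open Scope ring_scope.

(** * Euclidean inner product and norm *)

Section Euclidean.
Context (R : realType) (m : nat).
Implicit Types u v w : 'cV[R]_m.

Definition dotv u v : R := \sum_(j < m) u j 0 * v j 0.

Lemma dotvC u v : dotv u v = dotv v u.
Proof. by apply: eq_bigr => j _; rewrite mulrC. Qed.

Lemma dotvDl u v w : dotv (u + v) w = dotv u w + dotv v w.
Proof. by rewrite -big_split; apply: eq_bigr => j _; rewrite mxE mulrDl. Qed.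

Lemma dotvZl a u v : dotv (a *: u) v = a * dotv u v.
Proof. by rewrite mulr_sumr; apply: eq_bigr => j _; rewrite mxE mulrA. Qed.

Lemma dotvNl u v : dotv (- u) v = - dotv u v.
Proof. by rewrite -scaleN1r dotvZl mulN1r. Qed.

Lemma dotvDr u v w : dotv u (v + w) = dotv u v + dotv u w.
Proof. by rewrite !(dotvC u) dotvDl. Qed.

Lemma dotvZr a u v : dotv u (a *: v) = a * dotv u v.
Proof. by rewrite !(dotvC u) dotvZl. Qed.

Lemma dotvNr u v : dotv u (- v) = - dotv u v.
Proof. by rewrite !(dotvC u) dotvNl. Qed.

Lemma dot0v u : dotv 0 u = 0.
Proof. by rewrite -(scale0r u) dotvZl mul0r. Qed.

Definition dotvE := (dotvDl, dotvDr, dotvNl, dotvNr, dotvZl, dotvZr).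

Lemma dotvv_ge0 u : 0 <= dotv u u.
Proof. by apply: sumr_ge0 => j _; rewrite -expr2 sqr_ge0. Qed.

Lemma dotv_deltar u (j : 'I_m) : dotv u (delta_mx j 0) = u j 0.
Proof.
rewrite /dotv (bigD1 j) //= mxE !eqxx mulr1 big1 ?addr0 // => i /negbTE ij.
by rewrite mxE ij mulr0.
Qed.

Lemma ler_dotvl u v w : nonneg_orthant u -> (forall j, v j 0 <= w j 0) ->
  dotv u v <= dotv u w.
Proof. by move=> u0 vw; apply: ler_sum => j _; rewrite ler_wpM2l. Qed.

Lemma enorm_ge0 u : 0 <= enorm u.
Proof. exact: sqrtr_ge0. Qed.

Lemma sqr_enorm u : enorm u ^+ 2 = dotv u u.
Proof.
rewrite sqr_sqrtr; first by apply: eq_bigr => j _; rewrite expr2.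
by apply: sumr_ge0 => j _; rewrite sqr_ge0.
Qed.

Lemma enormE u : enorm u = Num.sqrt (dotv u u).
Proof. by rewrite -sqr_enorm sqrtr_sqr ger0_norm ?enorm_ge0. Qed.

Lemma enorm_le u a : 0 <= a -> dotv u u <= a ^+ 2 -> enorm u <= a.
Proof. by move=> a0; rewrite -sqr_enorm ler_sqr ?nnegrE ?enorm_ge0. Qed.

Lemma enorm0 : enorm (0 : 'cV[R]_m) = 0.
Proof. by rewrite enormE dot0v sqrtr0. Qed.

Lemma enormZ a u : enorm (a *: u) = `|a| * enorm u.
Proof.
by rewrite !enormE !dotvE mulrA -expr2 sqrtrM ?sqr_ge0 // sqrtr_sqr.
Qed.

Lemma enormN u : enorm (- u) = enorm u.
Proof. by rewrite -scaleN1r enormZ normrN1 mul1r. Qed.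

Lemma enorm_eq0 u : enorm u = 0 -> u = 0.
Proof.
move=> u0; have /eqP : dotv u u = 0 by rewrite -sqr_enorm u0 expr0n.
rewrite psumr_eq0 => [/allP uj|j _]; last by rewrite -expr2 sqr_ge0.
apply/colP => j; rewrite mxE; apply/eqP.
by have := uj j (mem_index_enum j); rewrite mulf_eq0 orbb.
Qed.

Lemma dotv_le_enorm u v : dotv u v <= enorm u * enorm v.
Proof.
have [/enorm_eq0->|u0] := eqVneq (enorm u) 0; first by rewrite dot0v enorm0 mul0r.
have [/enorm_eq0->|v0] := eqVneq (enorm v) 0.
  by rewrite dotvC dot0v enorm0 mulr0.
have uv : 0 < enorm u * enorm v by rewrite mulr_gt0 // lt_neqAle eq_sym enorm_ge0 andbT.
rewrite -(ler_pM2l uv).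
have := dotvv_ge0 (enorm v *: u - enorm u *: v).
by rewrite !dotvE -!sqr_enorm (dotvC v u); lra.
Qed.

Lemma enormD u v : enorm (u + v) <= enorm u + enorm v.
Proof.
apply: enorm_le; first by rewrite addr_ge0 ?enorm_ge0.
rewrite !dotvE (dotvC v u) -!sqr_enorm; have := dotv_le_enorm u v; lra.
Qed.

End Euclidean.

(** Along the [j]-th unit vector with step [t], the difference quotient lies within [c * |t|] of
    [p j 0]. *)
Lemma grad_sandwich (R : realType) (m : nat) (F : 'cV[R]_m -> R) (l p : 'cV[R]_m)
    (c : R) : 0 <= c ->
  (forall z, F l + dotv z p - c * dotv z z <= F (l + z) <= F l + dotv z p) ->
  grad F l = p.
Proof.
move=> c0 Fp; apply/colP => j; rewrite mxE.
rewrite /derive; apply: cvg_lim => //.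
apply/cvgrPdist_le => e e0.
near=> t.
have t0 : t != 0 by near: t; exact: nbhs_dnbhs_neq.
have te : c * `|t| <= e.
  rewrite (@le_trans _ _ ((c + 1) * `|t|)) ?ler_wpM2r// ?lerDl//.
  rewrite mulrC -ler_pdivlMr ?ltr_pwDr//.
  near: t; apply: dnbhs0_le; rewrite divr_gt0 ?ltr_pwDr//.
have := Fp (t *: delta_mx j 0).
rewrite !dotvE !(dotvC _ p) dotv_deltar dotv_deltar mxE !eqxx mulr1.
rewrite /= [l + _]addrC; set D := F (_ + _) => /andP[D1 D2].
have -> : p j 0 - t^-1 *: (D - F l) = t^-1 * (t * p j 0 + F l - D).
  by rewrite /GRing.scale/=; field.
rewrite normrM normfV ger0_norm; last by lra.
rewrite ler_pdivrMl ?normr_gt0 // (le_trans _ (ler_wpM2l (normr_ge0 t) te)) //.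
rewrite mulrCA -normrM -expr2 ger0_norm ?sqr_ge0//; lra.
Unshelve. all: by end_near. Qed.

(** Where this is applied, the cap [1 / 2] keeps [1 - e] away from zero and gives [e ^+ 2 <= e]. *)
Lemma le_of_vanishing_error (R : realFieldType) (a b c : R) :
  (forall e, 0 < e <= 1 / 2 -> a <= b + e * c) -> a <= b.
Proof.
move=> H; apply/ler_addgt0Pr => e e0.
pose t := Num.min (1 / 2) (e / (`|c| + 1)).
have c1 : 0 < `|c| + 1 by rewrite ltr_pwDr.
have t0 : 0 < t by rewrite lt_min divr_gt0 //= divr_gt0.
apply: le_trans (H t _) _; first by rewrite t0 ge_min lexx.
rewrite lerD2l (@le_trans _ _ (t * (`|c| + 1))) //.
  by rewrite ler_pM2l // (le_trans (ler_norm c)) // lerDl.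
by rewrite -ler_pdivlMr // ge_min lexx orbT.
Qed.

(** * Infima of quadratically penalized linear functions over a convex set *)

Section Envelope.
Context (R : realType) (m : nat) (rho : R) (K : set (R * 'cV[R]_m)).
Context (G : 'cV[R]_m -> R).
Hypothesis rho0 : 0 < rho.
Implicit Types (l d : 'cV[R]_m) (z : R * 'cV[R]_m).

Definition penalized l z := z.1 + dotv l z.2 + rho / 2 * dotv z.2 z.2.

(** [G l] is the infimum of [penalized l] over [K], phrased with approximate minimizers so that none
    has to be exact. *)
Definition is_envelope := forall l,
  (forall z, K z -> G l <= penalized l z) /\
  (forall e : R, 0 < e -> exists2 z, K z & penalized l z <= G l + e).

Hypothesis Kconv : forall z z' (t : R), 0 <= t <= 1 -> K z -> K z' ->
  K (t * z.1 + (1 - t) * z'.1, t *: z.2 + (1 - t) *: z'.2).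
Hypothesis GK : is_envelope.

(** The right side is exactly [penalized l] at the convex combination, which lies in [K]: the
    quadratic part has modulus [rho]. *)
Let envelope_strongly_convex l z z' (t : R) : 0 <= t <= 1 -> K z -> K z' ->
  G l <= t * penalized l z + (1 - t) * penalized l z'
    - rho / 2 * (t * (1 - t)) * dotv (z.2 - z'.2) (z.2 - z'.2).
Proof.
move=> t01 Kz Kz'; apply: (le_trans ((GK l).1 _ (Kconv t01 Kz Kz'))).
by rewrite /penalized /= !dotvE (dotvC z'.2 z.2); lra.
Qed.

(* The coordinates of approximate minimizers lie in pairwise intersecting
   intervals; a common point plays the role of the minimizer, which need not
   exist as K is not assumed closed. *)
Let approx_center l : exists p : 'cV[R]_m, forall (e : R) z j, 0 < e -> K z ->
  penalized l z <= G l + rho * e ^+ 2 / 8 -> `|z.2 j 0 - p j 0| <= e.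
Proof.
pose good e z := [/\ 0 < e, K z & penalized l z <= G l + rho * e ^+ 2 / 8].
pose S j := [set a | exists e z, good e z /\ a = z.2 j 0 - e].
have close j e z e' z' : good e z -> good e' z' ->
    z.2 j 0 - e <= z'.2 j 0 + e'.
  move=> [e0 Kz ze] [e'0 Kz' ze'].
  have h01 : 0 <= (2^-1 : R) <= 1 by rewrite invr_ge0 ler0n invf_le1 ?ler1n.
  have G1 := envelope_strongly_convex l h01 Kz Kz'.
  have G2 : (z.2 j 0 - z'.2 j 0) ^+ 2 <= dotv (z.2 - z'.2) (z.2 - z'.2).
    rewrite /dotv (bigD1 j) //= !mxE -expr2 lerDl.
    by apply: sumr_ge0 => i _; rewrite -expr2 sqr_ge0.
  (* At the midpoint the gap is [rho / 8] times the squared distance; this dictates the tolerance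
     [rho * e ^+ 2 / 8]. *)
  have G3 : rho * dotv (z.2 - z'.2) (z.2 - z'.2)
      <= rho * ((e ^+ 2 + e' ^+ 2) / 2) by lra.
  rewrite ler_pM2l // in G3.
  by rewrite leNgt; apply/negP => lt; nra.
exists (\col_j sup (S j)) => e z j e0 Kz ze; rewrite mxE ler_distl.
have gz : good e z by [].
have Sz : S j (z.2 j 0 - e) by exists e, z.
have ubS e' z' : good e' z' -> ubound (S j) (z'.2 j 0 + e').
  by move=> gz' _ [e1 [z1 [g1 ->]]]; exact: close g1 gz'.
apply/andP; split.
- by rewrite lerBlDr; apply: ge_sup; [exists (z.2 j 0 - e) | exact: ubS].
- by rewrite -lerBlDr; apply: ub_le_sup Sz; exists (z.2 j 0 + e); exact: ubS.
Qed.

(** Upper bound: an approximate minimizer for [l] is a trial point for [l + d]. Lower bound: strong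
    convexity compares it with an approximate minimizer for [l + d]. *)
Let envelope_sandwich l : exists p : 'cV[R]_m, forall d,
  G l + dotv d p - (2 * rho)^-1 * dotv d d <= G (l + d) <= G l + dotv d p.
Proof.
have [p pP] := approx_center l; exists p => d.
pose s := \sum_j `|d j 0|.
have s0 : 0 <= s by apply: sumr_ge0.
have near_min e : 0 < e -> exists2 z, K z &
    penalized l z <= G l + rho * e ^+ 2 / 8 /\ `|dotv d z.2 - dotv d p| <= e * s.
  move=> e0; have e1 : 0 < rho * e ^+ 2 / 8.
    by rewrite divr_gt0 // mulr_gt0 // exprn_gt0.
  have [z Kz ze] := (GK l).2 _ e1.
  exists z => //; split=> //.
  rewrite -dotvNr -dotvDr (le_trans (ler_norm_sum _ _ _)) // mulr_sumr.
  apply: ler_sum => j _; rewrite normrM mulrC ler_wpM2r // !mxE.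
  exact: pP e0 Kz ze.
apply/andP; split; last first.
  apply: (@le_of_vanishing_error _ _ _ (rho / 8 + s)) => e /andP[e0 e2].
  have [z Kz [ze zd]] := near_min _ e0.
  have := (GK (l + d)).1 _ Kz; move: ze zd; rewrite /penalized dotvDl ler_norml.
  have : rho * e ^+ 2 <= rho * e by rewrite ler_pM2l //; nra.
  by move=> ? ? /andP[_ ?]; lra.
rewrite lerBlDr.
apply: (@le_of_vanishing_error _ _ _ (rho / 8 + s + rho^-1 * dotv d d + 1)) => e.
move=> /andP[e0 e2].
have [z' Kz' ze'] := (GK (l + d)).2 _ e0.
have [z Kz [ze zd]] := near_min _ e0.
have e01 : 0 <= e <= 1 by apply/andP; split; lra.
(* Weight [e] on [z']: the error of [z] is of order [e ^+ 2], hence still vanishes after the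
   division by [e] in [gap]. *)
have := envelope_strongly_convex l e01 Kz' Kz.
set w := z'.2 - z.2 => gap.
have wd : dotv d z'.2 = dotv d w + dotv d z.2.
  by rewrite -dotvDr /w subrK.
clearbody w.
(* Complete the square with coefficient [rho * (1 - e)], then use [1 / (1 - e) <= 1 + 2 * e] for
   [e <= 1 / 2]. *)
have young : - dotv d w <= (2 * rho)^-1 * (1 + 2 * e) * dotv d d
    + rho / 2 * (1 - e) * dotv w w.
  have /(_ (d + (rho * (1 - e)) *: w)) := @dotvv_ge0 R m.
  rewrite !dotvE (dotvC w d) => sq.
  have r1 : 0 < rho * (1 - e) by rewrite mulr_gt0 //; lra.
  have dd := dotvv_ge0 d.
  have : 0 <= (2 * rho * (1 - e))^-1 * (dotv d d) + dotv d w
              + rho / 2 * (1 - e) * dotv w w.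
    rewrite -(pmulr_rge0 _ r1).
    have -> : rho * (1 - e) * ((2 * rho * (1 - e))^-1 * (dotv d d) + dotv d w
        + rho / 2 * (1 - e) * dotv w w)
      = 2^-1 * (dotv d d + rho * (1 - e) * dotv d w +
       rho * (1 - e) * (dotv d w + rho * (1 - e) * dotv w w)).
      have en : 1 - e != 0 by apply: lt0r_neq0; lra.
      by field; rewrite en lt0r_neq0.
    by rewrite mulr_ge0 ?invr_ge0 //; lra.
  have : (2 * rho * (1 - e))^-1 <= (2 * rho)^-1 * (1 + 2 * e).
    rewrite invfM ler_pM2l ?invr_gt0 ?mulr_gt0 //.
    rewrite -[_^-1]mul1r ler_pdivrMr; nra.
  move=> /(ler_wpM2r dd); lra.
have {}gap : G l <= penalized l z' + e * (rho / 8) - rho / 2 * (1 - e) * dotv w w.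
  rewrite -(ler_pM2l e0); have : (1 - e) * penalized l z <= (1 - e) * (G l + rho * e ^+ 2 / 8).
    by rewrite ler_wpM2l //; lra.
  have : 0 < e * (rho * e ^+ 2) by rewrite !mulr_gt0 ?exprn_gt0.
  lra.
have : penalized (l + d) z' = penalized l z' + dotv d w + dotv d z.2.
  by rewrite /penalized dotvDl wd; lra.
move: zd; rewrite ler_norml => /andP[? _] ?.
have -> : G (l + d) + (2 * rho)^-1 * dotv d d + e * (rho / 8 + s + rho^-1 * dotv d d + 1)
  = (2 * rho)^-1 * (1 + 2 * e) * dotv d d + G (l + d) + e * (rho / 8) + e * s + e.
  by field; rewrite lt0r_neq0.
lra.
Qed.

(** The sandwich identifies its [p] as the gradient. The right half is concavity, the left half
    smoothness with constant [1 / rho]. *)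
Lemma envelope_grad l d :
  G l + dotv d (grad G l) - (2 * rho)^-1 * dotv d d <= G (l + d)
    <= G l + dotv d (grad G l).
Proof.
have [p pP] := envelope_sandwich l.
suff -> : grad G l = p by exact: pP.
by apply: grad_sandwich pP; rewrite invr_ge0 mulr_ge0 // ltW.
Qed.

(** Compare the lower bound on [G (l + d)] with the value of [z] at [l + d]; the choice
    [d = rho (p - z.2)] maximizes [<d, p - z.2> - |d|^2 / (2 rho)]. *)
Lemma approx_min_grad l z a : K z -> penalized l z <= G l + a ->
  enorm (z.2 - grad G l) ^+ 2 <= 2 * a / rho.
Proof.
move=> Kz za; rewrite sqr_enorm.
set p := grad G l; set d := rho *: (p - z.2).
have /andP[+ _] := envelope_grad l d.
have := (GK (l + d)).1 _ Kz; move: za.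
rewrite /penalized /d !dotvE -/p (dotvC z.2 p) ler_pdivlMr // => ? ?.
rewrite (_ : (2 * rho)^-1 * _ = rho / 2 * (dotv p p - dotv p z.2 - (dotv p z.2 - dotv z.2 z.2))).
  by lra.
by field; rewrite lt0r_neq0.
Qed.

(** With [p] the gradient, the chain [G l + rho/2 |p|^2 <= G (l + rho p) <= G ls <= G l + <ls - l,
    p>] bounds the [|p|^2] term in the expanded square. *)
Lemma prox_step_nonexpansive l ls : (forall l', G l' <= G ls) ->
  enorm (l + rho *: grad G l - ls) <= enorm (l - ls).
Proof.
move=> Gmax; apply: enorm_le; rewrite ?enorm_ge0 // sqr_enorm.
set p := grad G l; set d := rho *: p.
have /andP[+ _] := envelope_grad l d.
have /andP[_] := envelope_grad l (ls - l).
have := Gmax (l + d).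
rewrite [l + (ls - l)]addrC subrK -/p /d !dotvE (dotvC ls l) (dotvC p l) (dotvC p ls).
rewrite (_ : (2 * rho)^-1 * _ = rho / 2 * dotv p p); last by field; rewrite lt0r_neq0.
move=> h1 h2 h3.
have : rho * (rho / 2 * dotv p p) <= rho * (dotv ls p - dotv l p).
  by rewrite ler_pM2l //; lra.
lra.
Qed.

End Envelope.

(** * The augmented Lagrangian in slack form *)

Section AugmentedLagrangian.
Context (R : realType) (n m : nat) (rho : R).
Hypothesis rho0 : 0 < rho.

(** The projection onto the orthant is the componentwise [min (u, 0)], leaving the positive part as
    residual. *)
Lemma sqr_edist_nonpos (u : 'cV[R]_m) :
  Defs.edist (@nonpos_orthant R m) u ^+ 2 = \sum_j Num.max (u j 0) 0 ^+ 2.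
Proof.
have -> : Defs.edist (@nonpos_orthant R m) u = enorm (\col_j Num.max (u j 0) 0).
  apply/le_anti/andP; split.
    apply: ge_inf; first by exists 0 => _ [s _ <-]; exact: enorm_ge0.
    exists (\col_j Num.min (u j 0) 0) => [j|].
      by rewrite mxE ge_min lexx orbT.
    by congr enorm; apply/colP => j; rewrite !mxE; case: ltgtP; lra.
  apply: lb_le_inf; first by exists (enorm (u - 0)), 0 => // j; rewrite mxE.
  move=> _ [s s0 <-]; apply: enorm_le; rewrite ?enorm_ge0 // sqr_enorm.
  apply: ler_sum => j _; rewrite !mxE; have := s0 j.
  have := sqr_ge0 (u j 0 - s j 0); rewrite expr2.
  by have [?|?] := leP (u j 0) 0; nra.
by rewrite sqr_enorm; apply: eq_bigr => j _; rewrite mxE expr2.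
Qed.

(** Minimizer of [<l, w> + rho/2 |w|^2] over [w >= c]: the unconstrained minimizer [- l / rho],
    clamped from below by [c]. *)
Definition slack (l c : 'cV[R]_m) : 'cV[R]_m :=
  \col_j Num.max (c j 0) (- (l j 0 / rho)).

Lemma slack_ge (l c : 'cV[R]_m) j : c j 0 <= slack l c j 0.
Proof. by rewrite mxE le_max lexx. Qed.

(** Each coordinate contributes [rho/2 ((y + b)^2 - b^2)], which increases with the distance from
    [- b]. *)
Lemma slack_min a (l c w : 'cV[R]_m) : (forall j, c j 0 <= w j 0) ->
  penalized rho l (a, slack l c) <= penalized rho l (a, w).
Proof.
move=> cw; rewrite /penalized /= -!addrA lerD2l /dotv !mulr_sumr -!big_split.
apply: ler_sum => j _ /=; rewrite mxE.
have := cw j; set x := c j 0; set y := w j 0.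
set b := l j 0 / rho => xy.
have -> : l j 0 = rho * b by rewrite mulrC mulfVK ?lt0r_neq0.
clearbody b.
rewrite -!mulrA -!mulrDr ler_pM2l //.
have := sqr_ge0 (y + b); rewrite expr2.
by have [?|?] := leP x (- b); nra.
Qed.

(** Completing the square: the positive part of [l / rho + h] is [slack + l / rho], and the [|l|^2]
    terms cancel. *)
Lemma aug_lagrangianE d (f : 'cV[R]_n -> 'cV[R]_d -> \bar R)
    (h : 'cV[R]_n -> 'cV[R]_d -> 'cV[R]_m) x l t a : f x t = a%:E ->
  aug_lagrangian f h rho x l t = (penalized rho l (a, slack l (h x t)))%:E.
Proof.
move=> fa; rewrite /aug_lagrangian fa gt_eqF // -EFinD /penalized /= -addrA.
congr (_ + _)%:E.
rewrite sqr_edist_nonpos sqr_enorm /dotv !mulr_sumr mulr_suml -sumrB -big_split.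
apply: eq_bigr => j _ /=; rewrite !mxE.
set c := h x t j 0; set b := l j 0.
have -> : Num.max (rho^-1 * b + c) 0 = Num.max c (- (b / rho)) + b / rho.
  by rewrite addr_maxl addNr addrC mulrC.
by field; rewrite lt0r_neq0.
Qed.

(** For fixed [x] the augmented Lagrangian is itself an envelope, over [c >= a] and [w >= h x t],
    with exact minimizer the slack; [approx_min_grad] with zero error applies. *)
Lemma grad_lagrangianE d (f : 'cV[R]_n -> 'cV[R]_d -> \bar R)
    (h : 'cV[R]_n -> 'cV[R]_d -> 'cV[R]_m) x l t a : f x t = a%:E ->
  grad_lagrangian f h rho x l t = slack l (h x t).
Proof.
move=> fa; rewrite /grad_lagrangian.
under eq_fun do rewrite (aug_lagrangianE _ _ fa) /=.
set G := fun mu : 'cV[R]_m => _.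
pose K := [set z : R * 'cV[R]_m | a <= z.1 /\ forall j, h x t j 0 <= z.2 j 0].
have Kslack mu : K (a, slack mu (h x t)) by split=> //= j; exact: slack_ge.
have Kconv z z' (s : R) : 0 <= s <= 1 -> K z -> K z' ->
    K (s * z.1 + (1 - s) * z'.1, s *: z.2 + (1 - s) *: z'.2).
  move=> /andP[s0 s1] [za zh] [z'a z'h]; split => [|j] /=; first by nra.
  by rewrite !mxE; have := zh j; have := z'h j; nra.
have GK : is_envelope rho K G.
  move=> mu; split=> [z [za zh]|e e0].
    apply: le_trans (slack_min a mu zh) _.
    by rewrite /penalized /= !lerD2r.
  by exists (a, slack mu (h x t)) => //; rewrite lerDl ltW.
have := @approx_min_grad _ _ _ _ _ rho0 Kconv GK l _ 0 (Kslack l).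
rewrite addr0 mulr0 mul0r => /(_ (lexx _)); rewrite sqr_enorm /= => le0.
have /enorm_eq0/subr0_eq -> // : enorm (slack l (h x t) - grad G l) = 0.
by rewrite enormE; apply/eqP; rewrite sqrtr_eq0.
Qed.

End AugmentedLagrangian.

(** * Convex combinations and running averages *)

Lemma convex_setP (R : realType) (n : nat) (X : set 'cV[R]_n) x y (t : R) :
  convex_set X -> X x -> X y -> 0 <= t <= 1 -> X (t *: x + (1 - t) *: y).
Proof.
move=> cX Xx Xy /andP[t0 t1].
by have := cX x y (Itv01 t0 t1) (mem_set Xx) (mem_set Xy) => /set_mem.
Qed.

(** Induction: the next average puts weight [(k + 1) / (k + 2)] on the current one. *)
Lemma jensen_running_avg (R : realType) (n : nat) (X : set 'cV[R]_n)
    (phi : 'cV[R]_n -> R) (x : nat -> 'cV[R]_n) k :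
  convex_set X -> (forall i, X (x i)) ->
  (forall y z (t : R), X y -> X z -> 0 <= t <= 1 ->
     phi (t *: y + (1 - t) *: z) <= t * phi y + (1 - t) * phi z) ->
  X (running_avg x k) /\
  k.+1%:R * phi (running_avg x k) <= \sum_(0 <= i < k.+1) phi (x i).
Proof.
move=> cX Xx cphi; elim: k => [|k [IHX IH]].
  rewrite /running_avg big_ord_recl big_ord0 addr0 invr1 scale1r big_nat1 mul1r.
  by split.
pose t : R := k.+1%:R / k.+2%:R.
have k2 : k.+2%:R != 0 :> R by rewrite pnatr_eq0.
have t1 : 1 - t = k.+2%:R^-1.
  by rewrite /t -[X in X - _](mulfV k2) -mulrBl -natrB // subSnn mul1r.
have t01 : 0 <= t <= 1.
  by rewrite divr_ge0 ?ler0n //= -subr_ge0 t1 invr_ge0 ler0n.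
have -> : running_avg x k.+1 = t *: running_avg x k + (1 - t) *: x k.+1.
  rewrite /running_avg big_ord_recr /= scalerDr t1 scalerA /t.
  by rewrite mulrAC mulfV ?pnatr_eq0 // mul1r.
have tk : k.+2%:R * t = k.+1%:R by rewrite mulrC mulfVK.
clearbody t; split; first exact: convex_setP.
rewrite big_nat_recr //= (le_trans _ (lerD IH (lexx _))) //.
have := cphi _ _ _ IHX (Xx k.+1) t01.
rewrite -(ler_pM2l (_ : 0 < k.+2%:R)) ?ltr0n //.
by rewrite mulrDr !mulrA tk t1 mulfV // mul1r.
Qed.

(** * The augmented dual function as an envelope *)

Section DualFunction.
Context (R : realType) (n d m : nat) (rho : R).
Hypothesis rho0 : 0 < rho.
Context (X : set 'cV[R]_n) (f : 'cV[R]_n -> 'cV[R]_d -> \bar R).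
Context (h : 'cV[R]_n -> 'cV[R]_d -> 'cV[R]_m) (t : 'cV[R]_d).
Context (F : 'cV[R]_n -> R).
Hypothesis fE : forall y, X y -> f y t = (F y)%:E.

(** Up to boundary points, the epigraph of the perturbation function
    [w |-> inf { F y : h y t <= w }]. *)
Definition value_epigraph : set (R * 'cV[R]_m) :=
  [set z : R * 'cV[R]_m | exists y, [/\ X y, F y <= z.1 & forall j, h y t j 0 <= z.2 j 0]].

Lemma value_epigraph_convex : convex_set X ->
  (forall y z (s : R), X y -> X z -> 0 <= s <= 1 ->
     F (s *: y + (1 - s) *: z) <= s * F y + (1 - s) * F z) ->
  (forall y z (s : R),
     h (s *: y + (1 - s) *: z) t = s *: h y t + (1 - s) *: h z t) ->
  forall z z' (s : R), 0 <= s <= 1 -> value_epigraph z -> value_epigraph z' ->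
  value_epigraph (s * z.1 + (1 - s) * z'.1, s *: z.2 + (1 - s) *: z'.2).
Proof.
move=> cX cF hA z z' s s01 [y [Xy Fy hy]] [y' [Xy' Fy' hy']].
have /andP[s0 s1] := s01.
exists (s *: y + (1 - s) *: y'); split => [||j] /=; first exact: convex_setP.
  by apply: le_trans (cF _ _ _ Xy Xy' s01) _; nra.
by rewrite hA !mxE; have := hy j; have := hy' j; nra.
Qed.

Context (c0 : R) (ls : 'cV[R]_m) (x0 : 'cV[R]_n).
Hypothesis Xx0 : X x0.
Hypothesis ls0 : nonneg_orthant ls.
Hypothesis lbF : forall y, X y -> c0 <= F y + dotv ls (h y t).

(** Finite above because of [x0]. Below, [lbF] and completing the square in [w] give
    [c0 - |l - ls|^2 / (2 rho)]. *)
Lemma dual_funE l : dual_fun f h X rho l t = (fine (dual_fun f h X rho l t))%:E.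
Proof.
rewrite fineK // fin_numElt; apply/andP; split; last first.
  apply: le_lt_trans (_ : _ <= aug_lagrangian f h rho x0 l t)%E _.
    by apply: ereal_inf_lbound; exists x0.
  by rewrite (aug_lagrangianE rho0 _ _ (fE Xx0)) ltry.
apply: lt_le_trans (ltNyr (c0 - dotv (l - ls) (l - ls) / (2 * rho))) _.
apply/ereal_infP => _ [y Xy <-]; rewrite (aug_lagrangianE rho0 _ _ (fE Xy)) lee_fin.
rewrite /penalized /=; set w := slack _ _ _.
have lw : dotv ls (h y t) <= dotv ls w by apply: ler_dotvl => // j; exact: slack_ge.
have := lbF Xy; set a := l - ls.
have lE : dotv l w = dotv a w + dotv ls w by rewrite -dotvDl subrK.
have : 0 <= rho / 2 * dotv (rho^-1 *: a + w) (rho^-1 *: a + w).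
  by rewrite mulr_ge0 ?dotvv_ge0 // divr_ge0 // ltW.
have -> : rho / 2 * dotv (rho^-1 *: a + w) (rho^-1 *: a + w)
    = dotv a a / (2 * rho) + dotv a w + rho / 2 * dotv w w.
  by clearbody a w; rewrite !dotvE (dotvC w a); field; rewrite lt0r_neq0.
lra.
Qed.

(** Minimizing over [w] first, for fixed [y], recovers the augmented Lagrangian. *)
Lemma dual_fun_envelope :
  is_envelope rho value_epigraph (fun l => fine (dual_fun f h X rho l t)).
Proof.
move=> l; split=> [z [y [Xy Fy hy]]|e e0].
  rewrite -lee_fin -dual_funE.
  apply: le_trans (_ : _ <= aug_lagrangian f h rho y l t)%E _.
    by apply: ereal_inf_lbound; exists y.
  rewrite (aug_lagrangianE rho0 _ _ (fE Xy)) lee_fin.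
  apply: le_trans (slack_min rho0 _ _ hy) _.
  by rewrite /penalized /= !lerD2r.
have fin : dual_fun f h X rho l t \is a fin_num by rewrite dual_funE.
have [_ [y Xy <-]] := lb_ereal_inf_adherent e0 fin.
rewrite (aug_lagrangianE rho0 _ _ (fE Xy)) -/(dual_fun f h X rho l t) dual_funE.
rewrite -EFinD lte_fin => /ltW ye; exists (F y, slack rho l (h y t)) => //.
by exists y; split => // j; exact: slack_ge.
Qed.

End DualFunction.

(** * Telescoping, geometric and convergent sums *)

Lemma sum_telescope_le (R : numDomainType) (u v : nat -> R) k :
  (forall i, u i.+1 <= u i + v i) -> u k <= u 0%N + \sum_(0 <= i < k) v i.
Proof.
move=> uv; elim: k => [|k IH]; first by rewrite big_nil addr0.
by rewrite big_nat_recr //= addrA (le_trans (uv k)) // lerD2r.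
Qed.

Lemma geometric_sum_le (R : realFieldType) (q : R) k : 0 < q < 1 ->
  \sum_(0 <= i < k) q ^+ i <= (1 - q)^-1.
Proof.
move=> /andP[q0 q1]; rewrite -[_^-1]mul1r ler_pdivlMr ?subr_gt0 //.
suff -> : (\sum_(0 <= i < k) q ^+ i) * (1 - q) = 1 - q ^+ k.
  by rewrite lerBlDr lerDl exprn_ge0 // ltW.
elim: k => [|k IH]; first by rewrite big_nil mul0r expr0 subrr.
by rewrite big_nat_recr //= mulrDl IH exprS; lra.
Qed.

Lemma sum_le_limn (R : realType) (u : nat -> R) k : (forall i, 0 <= u i) ->
  cvgn (series u) -> \sum_(0 <= i < k) u i <= limn (series u).
Proof.
move=> u0 cu; apply: nondecreasing_cvgn_le cu k.
exact: nondecreasing_series.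
Qed.

(** Each root is at most the total [S] of the roots, so [a i <= S * sqrt (a i)] and the partial sums
    stay below [S * S]. *)
Lemma cvg_series_of_sqrt (R : realType) (a : nat -> R) : (forall i, 0 <= a i) ->
  cvgn (series (fun i => Num.sqrt (a i))) -> cvgn (series a).
Proof.
move=> a0 ca; apply: nondecreasing_is_cvgn; first exact: nondecreasing_series.
pose S := limn (series (fun i => Num.sqrt (a i))).
have sum_le k : \sum_(0 <= i < k) Num.sqrt (a i) <= S.
  by apply: sum_le_limn => // i; exact: sqrtr_ge0.
have S0 : 0 <= S by rewrite (le_trans _ (sum_le 0%N)) // big_nil.
exists (S * S) => _ [k _ <-].
apply: le_trans (ler_wpM2l S0 (sum_le k)); rewrite mulr_sumr.
apply: ler_sum_nat => i _; rewrite -{1}[a i]sqr_sqrtr // expr2.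
rewrite ler_wpM2r ?sqrtr_ge0 // (le_trans _ (sum_le i.+1)) //.
by rewrite big_nat_recr //= lerDr sumr_ge0 // => j _; exact: sqrtr_ge0.
Qed.

Theorem theorem4 (R : realType) (n d m : nat)
    (X : set 'cV[R]_n) (Theta : set 'cV[R]_d)
    (f : 'cV[R]_n -> 'cV[R]_d -> \bar R)
    (h : 'cV[R]_n -> 'cV[R]_d -> 'cV[R]_m)
    (ell : 'cV[R]_d -> R) (theta_star : 'cV[R]_d) (f_star : R)
    (A : 'cV[R]_d -> 'M[R]_(m, n)) (b : 'cV[R]_d -> 'cV[R]_m)
    (L_f L_h sigma_h kappa_X q_ell rho M_h : R)
    (alpha : nat -> R) (theta : nat -> 'cV[R]_d)
    (x : nat -> 'cV[R]_n) (lambda : nat -> 'cV[R]_m) :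
  (* problem data *)
  convex_set X -> compact X ->
  convex_set Theta -> compact Theta ->
  (forall y t, Theta t -> (-oo < f y t)%E) ->
  Theta theta_star ->
  (forall t, Theta t -> t != theta_star -> ell theta_star < ell t) ->
  opt_value f h X theta_star = f_star%:E ->
  (exists l, dual_solutions f h X theta_star l) ->
  ereal_sup [set dual_fun f h X 0 l theta_star | l in [set: 'cV[R]_m]]
    = f_star%:E ->
  (* (i) *)
  (forall t, Theta t -> econvex_on X (f ^~ t)) ->
  (forall t j, Theta t -> convex_function X (fun y => h y t j 0)) ->
  (* (ii) *)
  (forall y t1 t2, X y -> Theta t1 -> Theta t2 ->
     (`|f y t1 - f y t2| <= (L_f * enorm (t1 - t2))%:E)%E) ->
  (* (iii) *)
  (forall y t, Theta t -> h y t = A t *m y + b t) ->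
  [lipschitz A t | t in Theta] -> [lipschitz b t | t in Theta] ->
  (forall y t1 t2, X y -> Theta t1 -> Theta t2 ->
     enorm (h y t1 - h y t2) <= L_h * enorm (t1 - t2)) ->
  (forall t, Theta t ->
     [set h y t | y in @unit_ball R n]
       `<=` [set sigma_h *: u | u in @unit_ball R m]) ->
  (* (iv) *)
  (forall l t1 t2, nonneg_orthant l -> Theta t1 -> Theta t2 ->
     argmin_lagrangian f h X l t1
       `<=` [set y + (kappa_X * enorm (t1 - t2)) *: u
               | y in argmin_lagrangian f h X l t2 & u in @unit_ball R n]) ->
  (* (v) *)
  0 < q_ell < 1 ->
  (forall k, Theta (theta k)) ->
  (forall k, enorm (theta k - theta_star)
               <= q_ell ^+ k * enorm (theta 0%N - theta_star)) ->
  (* penalty, and Lipschitz constant of the dual gradient in the parameter *)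
  0 < rho ->
  0 <= M_h ->
  (forall l t1 t2, Theta t1 -> Theta t2 ->
     enorm (grad_dual f h X rho l t1 - grad_dual f h X rho l t2)
       <= M_h * enorm (t1 - t2)) ->
  (* inexactness and scheme *)
  (forall k, 0 <= alpha k) ->
  cvgn (series (fun k => Num.sqrt (alpha k))) ->
  inexact_alm f h X rho alpha theta x lambda ->
  forall lambda_star, dual_solutions f h X theta_star lambda_star ->
  let S_alpha := limn (series (fun i => Num.sqrt (alpha i))) in
  let D := enorm (theta 0%N - theta_star) in
  let C_lambda :=
    Num.sqrt (2 * rho) * S_alpha + rho * M_h * (D / (1 - q_ell))
    + enorm lambda_star in
  let B_g :=
    1 / (2 * rho) * enorm lambda_star ^+ 2
    + C_lambda * (Num.sqrt (2 / rho) * S_alpha + M_h * D / (1 - q_ell)) in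
  let C_1 := Num.sqrt (2 * B_g / rho + (C_lambda / rho) ^+ 2) in
  let C_2 := Num.sqrt (2 / rho) * S_alpha + (L_h + M_h) * D / (1 - q_ell) in
  let V := fun k : nat => C_1 / Num.sqrt k.+1%:R + C_2 / k.+1%:R in
  let C_bar := C_lambda + enorm lambda_star in
  let U :=
    rho / 2 * L_h ^+ 2 * (D ^+ 2 / (1 - q_ell ^+ 2))
    + (C_bar * L_h + 2 * L_f) * (D / (1 - q_ell))
    + limn (series alpha) in
  forall k : nat, (1 <= k)%N ->
    ((- (rho / 2) * V k ^+ 2 - enorm lambda_star * V k)%:E
       <= f (running_avg x k) theta_star - f_star%:E)%E /\
    (f (running_avg x k) theta_star - f_star%:E <= (U / k%:R)%:E)%E.
Proof.
move=> cX _ _ _ _ Thstar _ optE _ supE cf _ lipf hA _ _ liph _ _ q01 Thk thq.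
move=> rho0 M0 lipgrad alpha0 csqrt [l0 alg] ls lsol.
move=> S D C_lambda B_g C_1 C_2 V C_bar U k k1.

(* Finite data, convexity and weak duality *)
have Xx i : X (x i) by case: (alg i).
have D0 : 0 <= D by exact: enorm_ge0.
have [q0 q1] := andP q01.
pose E := D / (1 - q_ell).
(* [0 <= L * D] rather than [0 <= L]: Lipschitz constants may be negative when
   Theta is a singleton. *)
have lip_decay L i : 0 <= L * D -> 0 <= L * enorm (theta i - theta_star) <= q_ell ^+ i * (L * D).
  have := thq i; rewrite -/D; have := enorm_ge0 (theta i - theta_star).
  set e := enorm _ => e0 eq LD.
  have [D00|Dp] := eqVneq D 0.
    have -> : e = 0 by apply/le_anti; rewrite e0 andbT (le_trans eq) // D00 mulr0.
    by rewrite D00 !mulr0 lexx.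
  have L0 : 0 <= L by rewrite -(pmulr_lge0 _ (_ : 0 < D)) // lt_neqAle eq_sym Dp.
  by rewrite mulr_ge0 //= mulrCA ler_wpM2l.
(* [|+oo - +oo| = +oo], so (ii) with [t1 = t2] forces f to be finite on X. *)
have ffin y t : X y -> Theta t -> f y t \is a fin_num.
  move=> Xy Tt; have := lipf y t t Xy Tt Tt; rewrite subrr enorm0 mulr0.
  by case: (f y t).
have [F fE] : exists F : 'cV[R]_n -> 'cV[R]_d -> R,
    forall y t, X y -> Theta t -> f y t = (F y t)%:E.
  by exists (fun y t => fine (f y t)) => y t Xy Tt; rewrite fineK // ffin.
have lipF y t1 t2 : X y -> Theta t1 -> Theta t2 ->
    `|F y t1 - F y t2| <= L_f * enorm (t1 - t2).
  by move=> Xy T1 T2; have := lipf y t1 t2 Xy T1 T2; rewrite !fE // -EFinB abse_EFin lee_fin.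
have LfD : 0 <= L_f * D.
  by apply: le_trans (lipF (x 0%N) _ _ (Xx _) (Thk 0%N) Thstar).
have LhD : 0 <= L_h * D.
  by apply: le_trans (liph (x 0%N) _ _ (Xx _) (Thk 0%N) Thstar); exact: enorm_ge0.
have cF t y z (s : R) : Theta t -> X y -> X z -> 0 <= s <= 1 ->
    F (s *: y + (1 - s) *: z) t <= s * F y t + (1 - s) * F z t.
  move=> Tt Xy Xz s01; have := cf t Tt y z s Xy Xz s01.
  by rewrite (fE _ _ Xy Tt) (fE _ _ Xz Tt) fE ?lee_fin //; exact: convex_setP.
have hconv t y z (s : R) : Theta t ->
    h (s *: y + (1 - s) *: z) t = s *: h y t + (1 - s) *: h z t.
  move=> Tt; rewrite !hA // mulmxDr -!scalemxAr !scalerDr addrACA -scalerDl.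
  by rewrite subrKC scale1r.
have dualE : dual_fun f h X 0 ls theta_star = f_star%:E.
  rewrite -supE; apply/le_anti/andP; split.
    by apply: ereal_sup_ubound; exists ls.
  by apply: ge_ereal_sup => _ [mu _ <-]; exact: lsol.
(* Otherwise the dual value at [ls] would be [-oo], whereas it equals [f_star]. *)
have ls0 : nonneg_orthant ls.
  have [//|lsN] := pselect (nonneg_orthant ls).
  have := ereal_inf_lbound (imageP (fun y => aug_lagrangian f h 0 y ls theta_star) (Xx 0%N)).
  rewrite -/(dual_fun f h X 0 ls theta_star) dualE /aug_lagrangian eqxx.
  by rewrite memNset.
have weak_dual y : X y -> f_star <= F y theta_star + dotv ls (h y theta_star).
  move=> Xy; have := ereal_inf_lbound (imageP (fun y => aug_lagrangian f h 0 y ls theta_star) Xy).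
  rewrite -/(dual_fun f h X 0 ls theta_star) dualE /aug_lagrangian eqxx mem_set //.
  rewrite fE // -EFinD lee_fin.
  suff -> : (ls^T *m h y theta_star) 0 0 = dotv ls (h y theta_star) by [].
  by rewrite mxE; apply: eq_bigr => j _; rewrite mxE.
(* Weak duality moved from [theta_star] to [t]; this supplies the [c0] that makes the augmented dual
   finite at every parameter. *)
have lbF t : Theta t -> forall y, X y ->
    f_star - (L_f + enorm ls * L_h) * enorm (t - theta_star) <= F y t + dotv ls (h y t).
  move=> Tt y Xy; have := weak_dual y Xy.
  have := lipF y t theta_star Xy Tt Thstar; rewrite ler_norml => /andP[+ _].
  have := le_trans (dotv_le_enorm ls (h y theta_star - h y t)) (ler_wpM2l (enorm_ge0 _)
     (liph y theta_star t Xy Thstar Tt)).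
  by rewrite -(opprB t) enormN dotvDr dotvNr; lra.

(* Augmented dual functions for varying parameters *)
pose g t l := fine (dual_fun f h X rho l t).
have gE t l : Theta t -> dual_fun f h X rho l t = (g t l)%:E.
  by move=> Tt; apply: (dual_funE rho0 (fun y Xy => fE y t Xy Tt) (Xx 0%N) ls0 (lbF t Tt)).
have env t : Theta t -> is_envelope rho (value_epigraph X h t (F ^~ t)) (g t).
  by move=> Tt; apply: (dual_fun_envelope rho0 (fun y Xy => fE y t Xy Tt) (Xx 0%N) ls0 (lbF t Tt)).
have epi_conv t (Tt : Theta t) := value_epigraph_convex cX (fun y z s => cF t y z s Tt)
  (fun y z s => hconv t y z s Tt).
(* Trial pair: [h y t - h y theta_star >= h y t] for [y] feasible at theta_star. *)
have g_le t l : Theta t -> g t l <= f_star + (L_f + enorm l * L_h) * enorm (t - theta_star)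
    + rho / 2 * (L_h * enorm (t - theta_star)) ^+ 2.
  move=> Tt; set e := enorm (t - theta_star).
  rewrite -lerBlDr -lerBlDr -lee_fin -optE; apply/ereal_infP => _ [y [Xy hy] <-].
  rewrite fE // lee_fin.
  have Kz : value_epigraph X h t (F ^~ t) (F y t, h y t - h y theta_star).
    by exists y; split => // j; rewrite !mxE lerDl oppr_ge0; exact: hy.
  have := (env t Tt l).1 _ Kz; rewrite /penalized /= -sqr_enorm.
  have := lipF y t theta_star Xy Tt Thstar; rewrite -/e ler_norml => /andP[_ ?].
  have he := liph y t theta_star Xy Tt Thstar; rewrite -/e in he.
  have := le_trans (dotv_le_enorm l _) (ler_wpM2l (enorm_ge0 l) he).
  have : rho / 2 * enorm (h y t - h y theta_star) ^+ 2 <= rho / 2 * (L_h * e) ^+ 2.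
    rewrite ler_pM2l ?divr_gt0 // ler_sqr ?nnegrE ?enorm_ge0 //.
    by rewrite (le_trans _ he) // enorm_ge0.
  lra.
(* Both sides are compared with [f_star], so a Lagrangian dual solution also maximizes the augmented
   dual. *)
have g_max l : g theta_star l <= g theta_star ls.
  apply: (@le_trans _ _ f_star).
    by have := g_le theta_star l Thstar; rewrite subrr enorm0 !mulr0 expr0n mulr0 !addr0.
  apply/ler_addgt0Pr => e e0.
  have [[c w] [y [Xy Fy hy]]] := (env theta_star Thstar ls).2 _ e0.
  apply: le_trans; apply: le_trans (weak_dual y Xy) _.
  rewrite /penalized /= in Fy hy *.
  have := @ler_dotvl _ _ ls _ w ls0 hy; have := dotvv_ge0 w => w0.
  have : 0 <= rho / 2 * dotv w w by rewrite mulr_ge0 // divr_ge0 // ltW.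
  lra.

(* Boundedness of the multipliers *)
pose s i := slack rho (lambda i) (h (x i) (theta i)).
have lamS i : lambda i.+1 = lambda i + rho *: s i.
  by have [_ _ ->] := alg i; rewrite (grad_lagrangianE rho0 _ _ (fE _ _ (Xx i) (Thk i))).
have inexact i : penalized rho (lambda i) (F (x i) (theta i), s i)
    <= g (theta i) (lambda i) + alpha i.
  have [_ + _] := alg i.
  by rewrite (aug_lagrangianE rho0 _ _ (fE _ _ (Xx i) (Thk i))) gE // -EFinD lee_fin.
(* Split into the exact step at [theta_star], which is nonexpansive, the inexactness
   [rho * |s i - p| <= sqrt (2 rho alpha_i)], and the parameter error, controlled by [M_h]. *)
have step i : enorm (lambda i.+1 - ls) <= enorm (lambda i - ls)
    + (Num.sqrt (2 * rho) * Num.sqrt (alpha i) + rho * M_h * D * q_ell ^+ i).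
  pose p := grad (g (theta i)) (lambda i); pose ps := grad (g theta_star) (lambda i).
  have -> : lambda i.+1 - ls = (lambda i + rho *: ps - ls) + (rho *: (s i - p) + rho *: (p - ps)).
    by rewrite lamS; move: (s i) (p) (ps) => a b' c; apply/colP => j; rewrite !mxE; ring.
  apply: le_trans (enormD _ _) (lerD _ _).
    exact: (prox_step_nonexpansive rho0 (epi_conv _ Thstar) (env _ Thstar)).
  apply: le_trans (enormD _ _) (lerD _ _); rewrite enormZ gtr0_norm //.
    have Kz : value_epigraph X h (theta i) (F ^~ (theta i)) (F (x i) (theta i), s i).
      by exists (x i); split => // j; exact: slack_ge.
    have := approx_min_grad rho0 (epi_conv _ (Thk i)) (env _ (Thk i)) Kz (inexact i).
    rewrite -/p /= => sp.
    rewrite -sqrtrM ?mulr_ge0 ?(ltW rho0) // -[leLHS]ger0_norm ?mulr_ge0 ?enorm_ge0 ?(ltW rho0) //.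
    rewrite -sqrtr_sqr ler_sqrt ?mulr_ge0 ?(ltW rho0) // exprMn.
    apply: le_trans (ler_wpM2l (sqr_ge0 rho) sp) _.
    by rewrite le_eqVlt; apply/orP; left; apply/eqP; field; rewrite lt0r_neq0.
  rewrite -!mulrA ler_pM2l // (le_trans (lipgrad _ _ _ (Thk i) Thstar)) //.
  by rewrite ler_wpM2l // mulrC thq.
have sum_q j : \sum_(0 <= i < j) D * q_ell ^+ i <= E.
  by rewrite -mulr_sumr ler_wpM2l // geometric_sum_le.
have sum_sqrt j : \sum_(0 <= i < j) Num.sqrt (alpha i) <= S.
  by apply: sum_le_limn => // i; exact: sqrtr_ge0.
have lam_ls j : enorm (lambda j - ls) <= C_lambda.
  apply: le_trans (sum_telescope_le (u := fun i => enorm (lambda i - ls)) j step) _.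
  rewrite l0 sub0r enormN addrC lerD2r big_split /= lerD //.
    by rewrite -mulr_sumr ler_wpM2l ?sqrtr_ge0.
  under eq_bigr do rewrite -mulrA.
  by rewrite -mulr_sumr ler_wpM2l // mulr_ge0 // ltW.
have lam_le j : enorm (lambda j) <= C_bar.
  rewrite -(subrK ls (lambda j)); apply: le_trans (enormD _ _) _.
  by rewrite lerD2r.
have Cbar0 : 0 <= C_bar by exact: le_trans (enorm_ge0 _) (lam_le 0%N).
have Clam0 : 0 <= C_lambda by exact: le_trans (enorm_ge0 _) (lam_ls 0%N).
have S0 : 0 <= S by rewrite (le_trans _ (sum_sqrt 0%N)) // big_nil.

(* Jensen bounds at the averaged iterate *)
have k0 : 0 < k.+1%:R :> R by rewrite ltr0n.
have [Xavg avgF] := jensen_running_avg k cX Xx (fun y z s => cF theta_star y z s Thstar).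
(* Weak duality reads [f_star <= F + phi], so the lower bound reduces to bounding [phi] at the
   average. *)
pose phi y := dotv ls (h y theta_star).
have cphi y z (t : R) : X y -> X z -> 0 <= t <= 1 ->
    phi (t *: y + (1 - t) *: z) <= t * phi y + (1 - t) * phi z.
  by move=> *; rewrite /phi hconv // dotvDr !dotvZr.
have [_ avgphi] := jensen_running_avg k cX Xx cphi.

(* Upper bound on the suboptimality *)
rewrite (fE _ _ Xavg Thstar) -EFinB !lee_fin; split; last first.
  pose N i := enorm (lambda i) ^+ 2 / (2 * rho).
  (* [L_f] counts twice: once in [g_le], once for moving [F (x i)] to [theta_star]. The [L_h] terms
     come from [g_le] with [|lambda_i| <= C_bar]. *)
  pose v i := (C_bar * (L_h * D) + 2 * (L_f * D)) * q_ell ^+ i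
    + rho / 2 * (L_h * D) ^+ 2 * (q_ell ^+ 2) ^+ i + alpha i.
  pose u j := \sum_(0 <= i < j) (F (x i) theta_star - f_star) + N j.
  have uv i : u i.+1 <= u i + v i.
    rewrite /u big_nat_recr //= -!addrA lerD2l.
    (* As [lambda_(i+1) = lambda_i + rho s_i], the penalty terms are the increment of [N], which
       telescopes. *)
    have penE : penalized rho (lambda i) (F (x i) (theta i), s i)
        = F (x i) (theta i) + N i.+1 - N i.
      rewrite /penalized /N /= !sqr_enorm lamS !dotvE (dotvC (s i) (lambda i)).
      by field; rewrite lt0r_neq0.
    have := inexact i; rewrite penE.
    have := g_le (theta i) (lambda i) (Thk i).
    have := lipF (x i) (theta i) theta_star (Xx i) (Thk i) Thstar.
    rewrite ler_norml => /andP[+ _].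
    have /andP[_] := lip_decay _ i LfD; have /andP[Lh0] := lip_decay _ i LhD.
    set e := enorm (theta i - theta_star) => Lhe Lfe.
    have : enorm (lambda i) * (L_h * e) <= C_bar * (q_ell ^+ i * (L_h * D)).
      by apply: ler_pM => //; exact: enorm_ge0.
    have : rho / 2 * (L_h * e) ^+ 2 <= rho / 2 * (L_h * D) ^+ 2 * (q_ell ^+ 2) ^+ i.
      rewrite -[leRHS]mulrA exprAC -exprMn [L_h * D * _]mulrC.
      by rewrite ler_pM2l ?divr_gt0 // ler_sqr ?nnegrE // (le_trans Lh0).
    by rewrite /v; lra.
  have := sum_telescope_le k.+1 uv.
  have -> : u 0%N = 0 by rewrite /u /N big_nil l0 enorm0 expr0n mul0r addr0.
  rewrite add0r => sumv.
  have vU : \sum_(0 <= i < k.+1) v i <= U.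
    have -> : U = (C_bar * (L_h * D) + 2 * (L_f * D)) * (1 - q_ell)^-1
        + rho / 2 * (L_h * D) ^+ 2 * (1 - q_ell ^+ 2)^-1 + limn (series alpha).
      by rewrite /U; congr (_ + _); rewrite exprMn; ring.
    rewrite !big_split /= -!mulr_sumr; apply: lerD; [apply: lerD|].
    - by rewrite ler_wpM2l ?geometric_sum_le // addr_ge0 // mulr_ge0.
    - rewrite ler_wpM2l ?geometric_sum_le ?exprn_gt0 ?expr_lt1 ?(ltW q0) //.
      by rewrite mulr_ge0 ?sqr_ge0 // divr_ge0 // ltW.
    - by apply: sum_le_limn => //; exact: cvg_series_of_sqrt.
  (* Allows [U / (k + 1)] to be relaxed to [U / k]. *)
  have U0 : 0 <= U.
    apply: le_trans vU; apply: sumr_ge0 => i _.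
    have q0' := ltW q0; have rho0' := ltW rho0; have LhD2 := sqr_ge0 (L_h * D).
    have r2 : 0 <= rho / 2 by rewrite divr_ge0.
    rewrite addr_ge0 // addr_ge0 // mulr_ge0 ?exprn_ge0 ?sqr_ge0 //; last exact: mulr_ge0.
    by rewrite addr_ge0 // mulr_ge0.
  have : k.+1%:R * (F (running_avg x k) theta_star - f_star) <= U.
    have N0 : 0 <= N k.+1 by rewrite divr_ge0 ?sqr_ge0 // mulr_ge0 // ltW.
    move: (le_trans sumv vU); rewrite /u sumrB [X in _ - X]sumr_const_nat subn0.
    by rewrite -[f_star *+ _]mulr_natl; lra.
  rewrite mulrC -ler_pdivlMr // => /le_trans; apply.
  by rewrite ler_wpM2l // lef_pV2 ?posrE ?ltr0n // ler_nat.

(* Lower bound on the suboptimality *)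
have phi_le : k.+1%:R * phi (running_avg x k) <= enorm ls * (C_bar / rho + L_h * E).
  apply: le_trans avgphi _.
  (* [<ls, s_i>] is the increment of [<ls, lambda_i> / rho]; subtracting it leaves only the
     geometric parameter error. *)
  pose u j := \sum_(0 <= i < j) phi (x i) - dotv ls (lambda j) / rho.
  have uv i : u i.+1 <= u i + enorm ls * (L_h * D) * q_ell ^+ i.
    have hs : phi (x i) <= dotv ls (s i) + enorm ls * (q_ell ^+ i * (L_h * D)).
      have /andP[_ Lhe] := lip_decay _ i LhD.
      have hx := liph (x i) theta_star (theta i) (Xx i) Thstar (Thk i).
      rewrite -(opprB (theta i)) enormN in hx.
      have := le_trans (dotv_le_enorm ls _) (ler_wpM2l (enorm_ge0 ls) (le_trans hx Lhe)).
      have : dotv ls (h (x i) (theta i)) <= dotv ls (s i).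
        by apply: ler_dotvl => // j; exact: slack_ge.
      by rewrite /phi dotvDr dotvNr; lra.
    rewrite /u big_nat_recr //= lamS dotvDr dotvZr mulrDl [rho * _ / rho]mulrAC.
    by rewrite mulfV ?lt0r_neq0 // mul1r; lra.
  have := sum_telescope_le k.+1 uv.
  have -> : u 0%N = 0 by rewrite /u big_nil l0 dotvC dot0v mul0r subr0.
  rewrite add0r -mulr_sumr /u => sumv.
  have lsLh : 0 <= enorm ls * (L_h * D) by rewrite mulr_ge0 ?enorm_ge0.
  have := ler_wpM2l lsLh (geometric_sum_le k.+1 q01).
  have : dotv ls (lambda k.+1) / rho <= enorm ls * C_bar / rho.
    rewrite ler_pM2r ?invr_gt0 // (le_trans (dotv_le_enorm _ _)) //.
    by rewrite ler_wpM2l ?enorm_ge0.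
  by rewrite /E; lra.
have V_ge : (C_bar / rho + L_h * E) / k.+1%:R <= V k.
  rewrite mulrDl /V lerD //.
    pose r := Num.sqrt (k.+1%:R : R).
    have r0 : 0 < r by rewrite sqrtr_gt0.
    have r2 : r ^+ 2 = k.+1%:R by rewrite sqr_sqrtr // ltW.
    rewrite -/r -r2 ler_pdivrMr ?exprn_gt0 // mulrAC expr2 mulrA mulfK ?lt0r_neq0 //.
    (* Here [k >= 1] enters: [(a + b')^2 <= 2 (a^2 + b'^2) <= r^2 C_1^2]. *)
    have rge : 2 <= r ^+ 2 by rewrite r2 (ler_nat _ 2).
    (* The first summand of [B_g] gives exactly [(|ls| / rho)^2]; the other is nonnegative. *)
    have Bg : (enorm ls / rho) ^+ 2 <= 2 * B_g / rho.
      have : 0 <= C_lambda * (Num.sqrt (2 / rho) * S + M_h * D / (1 - q_ell)).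
        rewrite mulr_ge0 // addr_ge0 // ?mulr_ge0 ?sqrtr_ge0 // invr_ge0 subr_ge0 ltW //.
      rewrite /B_g; set Z := C_lambda * _ => Z0.
      have -> : 2 * (1 / (2 * rho) * enorm ls ^+ 2 + Z) / rho = (enorm ls / rho) ^+ 2 + 2 * Z / rho.
        by field; rewrite lt0r_neq0.
      by rewrite lerDl; apply: divr_ge0; [apply: mulr_ge0 | apply: ltW].
    have C1E : C_1 ^+ 2 = 2 * B_g / rho + (C_lambda / rho) ^+ 2.
      by rewrite sqr_sqrtr // addr_ge0 ?sqr_ge0 // (le_trans _ Bg) ?sqr_ge0.
    have C10 : 0 <= C_1 by exact: sqrtr_ge0.
    rewrite -ler_sqr ?nnegrE; last 2 first.
    - by rewrite divr_ge0 // ltW.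
    - by rewrite mulr_ge0 // ltW.
    rewrite [leRHS]exprMn /C_bar mulrDl.
    set a := C_lambda / rho in C1E *; set b' := enorm ls / rho in Bg *.
    have := sqr_ge0 (a - b'); have := sqr_ge0 a; have := sqr_ge0 b'.
    have := ler_wpM2l (sqr_ge0 C_1) rge; lra.
  rewrite ler_pM2r ?invr_gt0 // /C_2 /E mulrDl mulrA.
  have : 0 <= M_h * D / (1 - q_ell) by rewrite mulr_ge0 ?mulr_ge0 // invr_ge0 subr_ge0 ltW.
  have : 0 <= Num.sqrt (2 / rho) * S by rewrite mulr_ge0 ?sqrtr_ge0.
  by rewrite mulrDl; lra.
have fF := weak_dual _ Xavg.
have : phi (running_avg x k) <= enorm ls * V k.
  apply: le_trans (ler_wpM2l (enorm_ge0 ls) V_ge).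
  by rewrite mulrA ler_pdivlMr // mulrC.
have : 0 <= rho / 2 * V k ^+ 2 by rewrite mulr_ge0 ?sqr_ge0 // divr_ge0 // ltW.
rewrite /phi; lra.
Qed.
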